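(* Let $A, B\in\mathbb{R}_+^{3\times 3}$ be SR-matrices (symmetrically reciprocal matrices). Write $\hat A = A/\mu(A)$, $\hat B = B/\mu(B)$ and $\hat S=\hat A\oplus\hat B$. The following are equivalent: (i) $\mu(\hat S)=1$; (ii) $A$ and $B$ commute in the max algebra, i.e. $A\otimes B=B\otimes A$; (iii) there exists a vector $x\in\operatorname{int}(\mathbb{R}^3_+)$ with $A\otimes x\le \mu(A)x$ and $B\otimes x\le\mu(B)x$.
   Context: $\mathbb{R}_+$ is the set of nonnegative reals and $\operatorname{int}(\mathbb{R}^n_+)$ is the set of $n$-tuples of positive reals. An SR-matrix (symmetrically reciprocal matrix) is a matrix $A$ with all entries positive, $a_{ii}=1$ for all $i$ and $a_{ij}a_{ji}=1$ for all $i\neq j$. Max algebra: $a\oplus b=\max(a,b)$, $a\otimes b=ab$ on $\mathbb{R}_+$, extended to matrices and vectors: $(A\oplus B)_{ij}=\max(a_{ij},b_{ij})$, $(A\otimes B)_{ij}=\max_k a_{ik}b_{kj}$, $(A\otimes x)_i=\max_j a_{ij}x_j$. Vector inequalities are entrywise. For $A\in\mathbb{R}_+^{n\times n}$, $\mu(A)$ is the maximal cycle geometric mean: the maximum of $(a_{i_1i_2}a_{i_2i_3}\cdots a_{i_ki_1})^{1/k}$ over all $k\ge 1$ and all sequences of distinct indices $i_1,\dots,i_k$. For an SR-matrix, $\mu(A)\ge 1$. *)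

(* Defs.v *)
From HB Require Import structures.
From mathcomp Require Import all_boot all_order all_algebra.
From mathcomp Require Import reals exp.
Set Implicit Arguments.
Unset Strict Implicit.
Unset Printing Implicit Defensive.
Import Order.TTheory GRing.Theory Num.Theory.
Local Open Scope ring_scope.

(* The max algebra lives on the nonnegative reals, where 0 is the neutral
   element of max: it is used below as the base value of all iterated maxima,
   so these definitions are meaningful for entrywise nonnegative matrices. *)

Definition max_addmx (R : realType) (m n : nat) (A B : 'M[R]_(m, n)) :
  'M[R]_(m, n) := \matrix_(i, j) Num.max (A i j) (B i j).

Definition max_mulmx (R : realType) (m n p : nat)
  (A : 'M[R]_(m, n)) (B : 'M[R]_(n, p)) : 'M[R]_(m, p) :=
  \matrix_(i, j) \big[Num.max/0]_(k < n) (A i k * B k j).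

Definition mx_le (R : realType) (m n : nat) (A B : 'M[R]_(m, n)) : Prop :=
  forall i j, A i j <= B i j.

Definition SR_matrix (R : realType) (n : nat) (A : 'M[R]_n) : Prop :=
  [/\ forall i j, 0 < A i j,
      forall i, A i i = 1
    & forall i j, i != j -> A i j * A j i = 1].

(* [ordS] is the cyclic successor, so the last factor closes the cycle. *)
Definition cycle_prod (R : realType) (n k : nat) (A : 'M[R]_n)
  (s : k.-tuple 'I_n) : R :=
  \prod_(l < k) A (tnth s l) (tnth s (ordS l)).

(* Distinctness of the indices bounds the cycle length by [n]; [k : 'I_n]
   stands for the length [k.+1]. *)
Definition max_cycle_mean (R : realType) (n : nat) (A : 'M[R]_n) : R :=
  \big[Num.max/0]_(k < n) \big[Num.max/0]_(s : k.+1.-tuple 'I_n | uniq s)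
    (cycle_prod A s `^ (k.+1%:R)^-1).

Definition normalized_mx (R : realType) (n : nat) (A : 'M[R]_n) : 'M[R]_n :=
  (max_cycle_mean A)^-1 *: A.

(* Main.v *)
(* Conjugation by a diagonal matrix turns a 3x3 SR-matrix [A] into a circulant
   one, so [A i (i + e) = mu(A) x_i / x_(i+e)] for some positive [x] and some
   nonzero [e] in Z/3. The vector [x] is an eigenvector of [A] for [mu(A)], and
   going once around the critical cycle shows that it is, up to scaling, the
   only positive subeigenvector. Hence (iii) says that [A] and [B] are
   circulant in the same diagonal coordinates, and circulants commute.
   Conversely, if [A] and [B] commute then [B x] is an eigenvector of [A], so
   it is a multiple of [x]. Finally, if the mean of the normalized sum is 1,
   its 2- and 3-cycles mixing critical edges of [A] and [B] force their two
   eigenvectors to be proportional. *)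
Require Import Defs.
From mathcomp Require Import all_boot all_order all_algebra.
From mathcomp Require Import reals exp.
From mathcomp Require Import ring.
Import Order.TTheory GRing.Theory Num.Theory.
Local Open Scope ring_scope.

Section MaxAlgebra.
Set Implicit Arguments.
Unset Strict Implicit.
Variables (R : realType).

(** * Max-algebra products *)

Lemma max_mulmx_ge {m n p} (A : 'M[R]_(m, n)) (B : 'M[R]_(n, p)) i k j :
  A i k * B k j <= max_mulmx A B i j.
Proof. by rewrite mxE; exact: (le_bigmax _ (fun k => A i k * B k j)). Qed.

Lemma max_mulmx_le {m n p} (A : 'M[R]_(m, n)) (B : 'M[R]_(n, p)) i j c :
  0 <= c -> (forall k, A i k * B k j <= c) -> max_mulmx A B i j <= c.
Proof. by move=> c0 le_c; rewrite mxE; exact: bigmax_le. Qed.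

Lemma max_mulmx_ge0 {m n p} (A : 'M[R]_(m, n)) (B : 'M[R]_(n, p)) i j :
  0 <= max_mulmx A B i j.
Proof. by rewrite mxE bigmax_ge_id. Qed.

Lemma mulr_bigmax (n : nat) (c : R) (F : 'I_n -> R) : 0 <= c ->
  c * \big[Num.max/0]_(k < n) F k = \big[Num.max/0]_(k < n) (c * F k).
Proof.
move=> c0; apply: (big_morph ( *%R c)); last exact: mulr0.
by move=> x y; rewrite maxr_pMr.
Qed.

(** Half of associativity: nonnegativity of [A] lets [A i k] move inside the inner maximum, and
    nonnegativity of [C] keeps the comparison with the outer product monotone. The next lemma is the
    other half, with these roles exchanged. *)
Lemma max_mulmxA_le {m n p q} (A : 'M[R]_(m, n)) (B : 'M[R]_(n, p))
    (C : 'M[R]_(p, q)) :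
  (forall i j, 0 <= A i j) -> (forall i j, 0 <= C i j) ->
  mx_le (max_mulmx A (max_mulmx B C)) (max_mulmx (max_mulmx A B) C).
Proof.
move=> A0 C0 i j; apply: max_mulmx_le => [|k]; first exact: max_mulmx_ge0.
rewrite mxE mulr_bigmax //; apply: bigmax_le => [|l _].
  exact: max_mulmx_ge0.
rewrite mulrA (le_trans _ (max_mulmx_ge _ _ i l j)) //.
by rewrite ler_wpM2r // max_mulmx_ge.
Qed.

Lemma max_mulmxA_ge {m n p q} (A : 'M[R]_(m, n)) (B : 'M[R]_(n, p))
    (C : 'M[R]_(p, q)) :
  (forall i j, 0 <= A i j) -> (forall i j, 0 <= C i j) ->
  mx_le (max_mulmx (max_mulmx A B) C) (max_mulmx A (max_mulmx B C)).
Proof.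
move=> A0 C0 i j; apply: max_mulmx_le => [|k]; first exact: max_mulmx_ge0.
rewrite mulrC [max_mulmx A B i k]mxE mulr_bigmax //.
apply: bigmax_le => [|l _]; first exact: max_mulmx_ge0.
rewrite mulrC -mulrA (le_trans _ (max_mulmx_ge _ _ i l j)) //.
by rewrite ler_wpM2l // max_mulmx_ge.
Qed.

Lemma max_mulmx_scale_leP (n : nat) (A : 'M[R]_n) (x : 'cV[R]_n) (c : R) :
  0 <= c -> (forall i, 0 < x i 0) ->
  mx_le (max_mulmx A x) (c *: x) <->
  (forall i j, A i j * x j 0 <= c * x i 0).
Proof.
move=> c0 x0; split=> [le_c i j|le_c i j].
  by have := le_c i 0; rewrite [X in _ <= X]mxE; apply/le_trans/max_mulmx_ge.
rewrite (ord1 j) [X in _ <= X]mxE; apply: max_mulmx_le => //.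
by rewrite mulr_ge0 // ltW.
Qed.

(** * Bounds on the maximal cycle mean *)

Lemma max_cycle_mean_ge0 (n : nat) (A : 'M[R]_n) : 0 <= max_cycle_mean A.
Proof. exact: bigmax_ge_id. Qed.

(** Multiplying the hypotheses along a cycle, the values of [x] appear on both sides up to a cyclic
    shift by [ordS], so they cancel and leave the cycle product at most [c ^+ k.+1]. *)
Lemma max_cycle_mean_le (n : nat) (A : 'M[R]_n) (x : 'I_n -> R) (c : R) :
  0 <= c -> (forall i j, 0 <= A i j) -> (forall i, 0 < x i) ->
  (forall i j, A i j * x j <= c * x i) -> max_cycle_mean A <= c.
Proof.
move=> c0 A0 x0 le_c; apply: bigmax_le => // k _; apply: bigmax_le => // s _.
have cyc0 : 0 <= cycle_prod A s by apply: prodr_ge0.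
suff cyc_le : cycle_prod A s <= c ^+ k.+1.
  apply: (@le_trans _ _ ((c ^+ k.+1) `^ k.+1%:R^-1)).
    by rewrite ge0_ler_powR // ?nnegrE ?exprn_ge0 // invr_ge0 ler0n.
  by rewrite -powR_mulrn // -powRrM mulfV ?pnatr_eq0 // powRr1.
have P0 : 0 < \prod_(l < k.+1) x (tnth s l) by apply: prodr_gt0.
rewrite -(ler_pM2r P0).
rewrite [X in _ * X <= _](reindex (@ordS k.+1)) /=; last first.
  exact/onW_bij/ordS_bij.
have -> : c ^+ k.+1 = \prod_(l < k.+1) c by rewrite prodr_const card_ord.
rewrite -!big_split /=; apply: ler_prod => l _.
by rewrite le_c mulr_ge0 // ltW.
Qed.

Lemma cycle_prod_le (n k : nat) (A : 'M[R]_n) (s : k.+1.-tuple 'I_n) :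
  (forall i j, 0 <= A i j) -> uniq s ->
  cycle_prod A s <= max_cycle_mean A ^+ k.+1.
Proof.
move=> A0 us.
(* Distinct indices make the length [k.+1] at most [n], so [k] is one of the indices of the outer
   maximum. *)
have kn : (k < n)%N.
  by rewrite -(size_tuple s) -(card_uniqP us) -[X in (_ <= X)%N]card_ord max_card.
have cyc0 : 0 <= cycle_prod A s by apply: prodr_ge0.
have : cycle_prod A s `^ k.+1%:R^-1 <= max_cycle_mean A.
  rewrite /max_cycle_mean.
  apply: le_trans (le_bigmax _ _ (Ordinal kn)).
  exact: (le_bigmax_cond _ (P := fun s : k.+1.-tuple 'I_n => uniq s)).
move=> /(lerXn2r k.+1); rewrite !nnegrE powR_ge0 max_cycle_mean_ge0.
move=> /(_ isT isT); apply: le_trans.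
by rewrite -powR_mulrn ?powR_ge0 // -powRrM mulVf ?pnatr_eq0 // powRr1.
Qed.

Lemma cycle2_le (n : nat) (A : 'M[R]_n) i j : (forall i j, 0 <= A i j) ->
  i != j -> A i j * A j i <= max_cycle_mean A ^+ 2.
Proof.
move=> A0 ij; have := @cycle_prod_le _ _ A [tuple i; j] A0.
by rewrite /= inE ij /cycle_prod 2!big_ord_recl big_ord0 mulr1; apply.
Qed.

Lemma cycle3_le (n : nat) (A : 'M[R]_n) i j k : (forall i j, 0 <= A i j) ->
  uniq [:: i; j; k] -> A i j * A j k * A k i <= max_cycle_mean A ^+ 3.
Proof.
move=> A0 uijk; have := @cycle_prod_le _ _ A [tuple i; j; k] A0 uijk.
by rewrite /cycle_prod 3!big_ord_recl big_ord0 mulr1 mulrA; apply.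
Qed.

End MaxAlgebra.

Section DimensionThree.
Set Implicit Arguments.
Unset Strict Implicit.
Variables (R : realType).
Implicit Types (A B : 'M[R]_3) (x y : 'cV[R]_3) (e i j k : 'I_3).

(** * Arithmetic of Z/3 and the circulant form of SR-matrices *)

Lemma I3_cases e i j : e != 0 -> [\/ j = i, j = i + e | j = i - e].
Proof.
move=> e0; suff /or3P[/eqP|/eqP|/eqP] : [|| j == i, j == i + e | j == i - e].
- by constructor 1.
- by constructor 2.
- by constructor 3.
by move: e i j e0; do 3! [case=> [[|[|[|?]]] ?] //].
Qed.

Lemma I3_addKK e i : i + e + e = i - e.
Proof. by apply/val_inj; move: i e; do 2! [case=> [[|[|[|?]]] ?] //]. Qed.

Lemma I3_shift_neq e i : e != 0 -> i + e != i.
Proof. by move=> e0; rewrite -subr_eq0 [i + e]addrC addrK. Qed.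

Lemma I3_opp e : e != 0 -> (- e != 0) && (- e != e).
Proof. by case: e => [[|[|[|?]]] ?]. Qed.

Lemma I3_uniq e i : e != 0 -> uniq [:: i; i + e; i - e].
Proof. by move: e i; do 2! [case=> [[|[|[|?]]] ?] //]. Qed.

(** Three steps by [e] return to the start, so the inequalities around the orbit close up into
    equalities. *)
Lemma I3_nonincreasing_const e (u : 'I_3 -> R) :
  e != 0 -> (forall i, u (i + e) <= u i) -> forall i j, u i = u j.
Proof.
move=> e0 le_u.
have le_uu i j : u j <= u i.
  have [->//|->//|->] := I3_cases i j e0.
  by rewrite -I3_addKK (le_trans (le_u _)).
by move=> i j; apply/le_anti; rewrite !le_uu.
Qed.

(* [A] is the conjugate by the diagonal matrix of [x] of the circulant matrix
   whose critical cycle is [0 -> e -> 2e -> 0] in Z/3 and has mean [r]. *)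
Definition cyclic_form A e (r : R) x :=
  [/\ e != 0, 1 <= r, forall i, 0 < x i 0
    & forall i, A i (i + e) = r * x i 0 / x (i + e) 0].

Lemma cyclic_form_rev A e r x i : SR_matrix A -> cyclic_form A e r x ->
  A i (i - e) = r^-1 * x i 0 / x (i - e) 0.
Proof.
move=> [A0 _ Ainv] [e0 r1 x0 Ae].
have r0 : 0 < r by apply: lt_le_trans r1.
have := Ae (i - e); rewrite subrK => Aie.
have ne : i - e != i by rewrite -{2}(subrK e i) eq_sym I3_shift_neq.
have := Ainv _ _ ne; rewrite Aie => inv.
have xi := lt0r_neq0 (x0 i); have xj := lt0r_neq0 (x0 (i - e)).
have r_neq := lt0r_neq0 r0.
(* The cancelled factor is [A (i - e) i], the reciprocal of the entry sought. *)
apply: (mulfI (_ : r * x (i - e) 0 / x i 0 != 0)).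
  by rewrite !mulf_neq0 ?invr_eq0.
by rewrite inv; field; rewrite r_neq xi xj.
Qed.

(** The circulant symbol [c] takes the values 1, [r] and [r^-1] at 0, [e] and [- e]. All are at most
    [r] because [1 <= r]. *)
Lemma cyclic_formE A e r x : SR_matrix A -> cyclic_form A e r x ->
  exists c : 'I_3 -> R, (forall k, c k <= r) /\
    (forall i j, A i j = x i 0 / x j 0 * c (j - i)).
Proof.
move=> hA hf; have [A0 Aii _] := hA; have [e0 r1 x0 Ae] := hf.
have r0 : 0 < r by apply: lt_le_trans r1.
exists (fun k => if k == 0 then 1 else if k == e then r else r^-1).
split=> [k|i j].
- do 2? case: ifP => _ //.
  by rewrite (le_trans _ r1) // invf_le1.
have xj := lt0r_neq0 (x0 j).
have [|->|jE] := I3_cases i j e0.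
- by move=> ->; rewrite subrr eqxx Aii mulr1 divff // lt0r_neq0.
- rewrite [i + e]addrC addrK (negPf e0) eqxx addrC Ae; ring.
- have /andP[/negPf neN0 /negPf neNe] := I3_opp e0.
  rewrite jE [i - e]addrC addrK neN0 neNe addrC.
  by rewrite (cyclic_form_rev _ hA hf); ring.
Qed.

(** The upper bound holds because [x] is a subeigenvector for [r]. The lower bound comes from the
    3-cycle in direction [e], whose product telescopes to [r ^+ 3]. *)
Lemma cyclic_form_mean A e r x : SR_matrix A -> cyclic_form A e r x ->
  max_cycle_mean A = r.
Proof.
move=> hA hf; have [A0 _ _] := hA; have [e0 r1 x0 Ae] := hf.
have Age0 i j : 0 <= A i j by rewrite ltW.
have r0 : 0 < r by apply: lt_le_trans r1.
have [c [c_le AE]] := cyclic_formE hA hf.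
apply/le_anti/andP; split.
  apply: (@max_cycle_mean_le _ _ _ (fun i => x i 0)) => // [|i j].
    exact: ltW.
  rewrite AE mulrAC divfK ?lt0r_neq0 // mulrC.
  by rewrite ler_pM2r.
have := cycle3_le Age0 (I3_uniq 0 e0).
have := Ae (0 - e); rewrite subrK => ->.
have := Ae (0 + e); rewrite I3_addKK => ->.
rewrite Ae.
rewrite (_ : _ * _ = r ^+ 3); last first.
  by field; rewrite !lt0r_neq0.
by rewrite ler_pXn2r // nnegrE ?max_cycle_mean_ge0 // ltW.
Qed.

(** The orientation [e] is chosen so that its 3-cycle has product at least 1, and [r] is the cube
    root of that product. *)
Lemma SR_cyclic_form A : SR_matrix A ->
  exists e x, cyclic_form A e (max_cycle_mean A) x.
Proof.
move=> hA; have [A0 _ Ainv] := hA.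
have ex_form e : e != 0 -> 1 <= A 0 e * A e (- e) * A (- e) 0 ->
    exists r x, cyclic_form A e r x.
  move=> e0; set t := _ * _ * _ => t1.
  have t0 : 0 < t by apply: lt_le_trans t1.
  pose r := t `^ 3%:R^-1.
  have rE : r ^+ 3 = t.
    by rewrite -powR_mulrn ?powR_ge0 // -powRrM mulVf ?pnatr_eq0 // powRr1 // ltW.
  have r0 : 0 < r by apply: powR_gt0.
  have r1 : 1 <= r.
    by rewrite -(@expr_ge1 _ 3) ?rE // ltW.
  (* With [x 0 0 = 1], the edges from 0 to [e] and from [- e] to 0 determine the other two
     coordinates. The remaining edge is then consistent because [r ^+ 3 = t]. *)
  pose x : 'cV[R]_3 := \col_i
    if i == 0 then 1 else if i == e then r / A 0 e else A (- e) 0 / r.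
  have /andP[/negPf neN0 /negPf neNe] := I3_opp e0.
  have xz : x 0 0 = 1 by rewrite mxE eqxx.
  have xe : x e 0 = r / A 0 e by rewrite mxE (negPf e0) eqxx.
  have xne : x (- e) 0 = A (- e) 0 / r by rewrite mxE neN0 neNe.
  have nA i j : A i j != 0 by rewrite lt0r_neq0.
  have r_neq : r != 0 by rewrite lt0r_neq0.
  exists r, x; split=> // i.
    rewrite mxE; do 2? [case: ifP => _ //]; exact: divr_gt0.
  have [->|->|->] := I3_cases 0 i e0; rewrite ?add0r ?sub0r.
  - by rewrite xz xe; field; rewrite r_neq nA.
  - have := I3_addKK e 0; rewrite add0r => ->; rewrite sub0r xe xne.
    rewrite (_ : _ / _ = r ^+ 3 / (A 0 e * A (- e) 0)); last first.
      by field; rewrite r_neq !nA.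
    by rewrite rE /t; field; rewrite !nA.
  - by rewrite addNr xz xne; field.
(* Reciprocity makes the products of the two orientations inverse to each other, so one of them is
   at least 1. *)
have [e [e0 h]] : exists e, e != 0 /\ 1 <= A 0 e * A e (- e) * A (- e) 0.
  have [h|/ltW h] := leP 1 (A 0 1 * A 1 (- 1) * A (- 1) 0); first by exists 1.
  exists (- 1); split=> //; rewrite opprK.
  have a := Ainv 0 1 isT; have b := Ainv 1 (- 1) isT.
  have c := Ainv (- 1) 0 isT.
  set t := (X in X <= 1) in h; set u := (X in 1 <= X).
  have tu : t * u = 1.
    transitivity ((A 0 1 * A 1 0) * (A 1 (- 1) * A (- 1) 1)
        * (A (- 1) 0 * A 0 (- 1))); first by rewrite /t /u; ring.
    by rewrite a b c !mulr1.
  have u0 : 0 < u by rewrite !mulr_gt0.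
  by rewrite -tu -[X in _ <= X]mul1r ler_pM2r.
have [r [x hf]] := ex_form e e0 h.
by exists e, x; rewrite (cyclic_form_mean hA hf).
Qed.

(** * Subeigenvectors and commutation of circulant forms *)

(** On a critical edge the inequality for [y] says that [y / x] does not increase from [i] to
    [i + e], hence this ratio is constant. *)
Lemma subeigen_cyclic_form_colinear A e x y :
  (forall i, 0 < y i 0) -> cyclic_form A e (max_cycle_mean A) x ->
  (forall i j, A i j * y j 0 <= max_cycle_mean A * y i 0) ->
  exists2 c, 0 < c & forall i, y i 0 = c * x i 0.
Proof.
move=> y0 [e0 r1 x0 Ae] le_y.
have r0 : 0 < max_cycle_mean A by apply: lt_le_trans r1.
have cst : forall i j, y i 0 / x i 0 = y j 0 / x j 0.
  apply: (@I3_nonincreasing_const e) => // i.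
  have := le_y i (i + e); rewrite Ae -!mulrA ler_pM2l //.
  rewrite ler_pdivlMr //; congr (_ <= _); ring.
exists (y 0 0 / x 0 0); first exact: divr_gt0.
by move=> i; rewrite (cst 0 i) divfK // lt0r_neq0.
Qed.

Lemma cyclic_form_scale A e r c x y : 0 < c ->
  (forall i, y i 0 = c * x i 0) -> cyclic_form A e r x -> cyclic_form A e r y.
Proof.
move=> c0 yE [e0 r1 x0 Ae]; split=> // i; rewrite !yE ?mulr_gt0 // Ae.
by field; rewrite !lt0r_neq0.
Qed.

Lemma cyclic_form_is_subeigen A e x : SR_matrix A ->
  cyclic_form A e (max_cycle_mean A) x ->
  forall i j, A i j * x j 0 <= max_cycle_mean A * x i 0.
Proof.
move=> hA hf i j; have [_ _ x0 _] := hf.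
have [c [c_le ->]] := cyclic_formE hA hf.
by rewrite mulrAC divfK ?lt0r_neq0 // mulrC ler_pM2r.
Qed.

Lemma cyclic_form_commute A B e e' r s x : SR_matrix A -> SR_matrix B ->
  cyclic_form A e r x -> cyclic_form B e' s x ->
  max_mulmx A B = max_mulmx B A.
Proof.
move=> hA hB fA fB; have [_ _ x0 _] := fA.
have [a [_ AE]] := cyclic_formE hA fA.
have [b [_ BE]] := cyclic_formE hB fB.
apply/matrixP=> i j; rewrite !mxE.
(* Both products are max-convolutions over Z/3. Replacing [k] by [i + j - k] exchanges the
   differences [k - i] and [j - k]. *)
rewrite (reindex_inj (can_inj (subKr (i + j)))) /=.
apply: eq_bigr => k _; rewrite !AE !BE.
have -> : j - (i + j - k) = k - i by ring.
have -> : i + j - k - i = j - k by ring.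
by field; rewrite !lt0r_neq0.
Qed.

(** * Implications between the three conditions *)

Definition subeigen A x :=
  forall i j, A i j * x j 0 <= max_cycle_mean A * x i 0.

Lemma subeigen_commute A B x : SR_matrix A -> SR_matrix B ->
  (forall i, 0 < x i 0) -> subeigen A x -> subeigen B x ->
  max_mulmx A B = max_mulmx B A.
Proof.
move=> hA hB x0 Ax Bx.
have [e [y fA]] := SR_cyclic_form hA; have [e' [z fB]] := SR_cyclic_form hB.
have [a a0 xy] := subeigen_cyclic_form_colinear x0 fA Ax.
have [b b0 xz] := subeigen_cyclic_form_colinear x0 fB Bx.
exact: cyclic_form_commute hA hB (cyclic_form_scale a0 xy fA)
  (cyclic_form_scale b0 xz fB).
Qed.

Lemma commute_subeigen A B : SR_matrix A -> SR_matrix B ->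
  max_mulmx A B = max_mulmx B A ->
  exists x, [/\ forall i, 0 < x i 0, subeigen A x & subeigen B x].
Proof.
move=> hA hB AB.
have [e [x fA]] := SR_cyclic_form hA; have [e' [z fB]] := SR_cyclic_form hB.
have [A0 _ _] := hA; have [B0 _ _] := hB.
have [_ muA1 x0 _] := fA; have [_ muB1 z0 _] := fB.
have Age0 i j : 0 <= A i j by rewrite ltW.
have Bge0 i j : 0 <= B i j by rewrite ltW.
have Ax := cyclic_form_is_subeigen hA fA; have Bz := cyclic_form_is_subeigen hB fB.
have xge0 i (j : 'I_1) : 0 <= x i j by rewrite (ord1 j) ltW.
pose y := max_mulmx B x.
have y0 i : 0 < y i 0.
  by apply: lt_le_trans (max_mulmx_ge B x i i 0); rewrite mulr_gt0.
have muA0 := max_cycle_mean_ge0 A.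
(* Commutation moves [A] past [B]: A(Bx) = B(Ax), which is at most mu(A) Bx. *)
have Ay : subeigen A y.
  move=> i j; apply: le_trans (max_mulmx_ge A y i j 0) _.
  apply: le_trans (max_mulmxA_le _ Age0 xge0 i 0) _; rewrite AB.
  apply: le_trans (max_mulmxA_ge _ Bge0 xge0 i 0) _.
  apply: max_mulmx_le => [|k]; first by rewrite mulr_ge0 // ltW.
  apply: (@le_trans _ _ (max_cycle_mean A * (B i k * x k 0))); last first.
    by rewrite ler_wpM2l // max_mulmx_ge.
  rewrite mulrCA ler_wpM2l //; apply: max_mulmx_le => //.
  by rewrite mulr_ge0.
have [c c0 yE] := subeigen_cyclic_form_colinear y0 fA Ay.
(* [B x = c x], and comparing [x] with the eigenvector [z] of [B] at an index
   maximizing [x / z] gives [c <= mu(B)]. *)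
have c_le : c <= max_cycle_mean B.
  have [i _ i_max] :=
    @arg_maxP _ _ _ (0 : 'I_3) xpredT (fun i => x i 0 / z i 0) isT.
  rewrite -(ler_pM2r (x0 i)) -yE; apply: max_mulmx_le => [|j].
    by rewrite mulr_ge0 ?max_cycle_mean_ge0.
  have : x j 0 / z j 0 <= x i 0 / z i 0 by exact: i_max.
  rewrite ler_pdivrMr // => /(ler_wpM2l (Bge0 i j)) h.
  apply: le_trans h _; rewrite mulrCA.
  apply: le_trans (ler_wpM2l _ (Bz i j)) _.
    by rewrite divr_ge0 // ltW.
  by rewrite mulrCA divfK // lt0r_neq0.
exists x; split=> // i j; apply: le_trans (max_mulmx_ge B x i j 0) _.
by rewrite -/y yE ler_pM2r.
Qed.

Lemma normalized_addE A B i j :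
  max_addmx (normalized_mx A) (normalized_mx B) i j =
  Num.max ((max_cycle_mean A)^-1 * A i j) ((max_cycle_mean B)^-1 * B i j).
Proof. by rewrite !mxE. Qed.

(** The common vector [x] is a subeigenvector of the normalized sum for the constant 1, so the mean
    is at most 1. Equality is reached on the critical 3-cycle of [A], whose normalized product is 1
    and is dominated by that of the sum. *)
Lemma subeigen_mean1 A B x : SR_matrix A -> SR_matrix B ->
  (forall i, 0 < x i 0) -> subeigen A x -> subeigen B x ->
  max_cycle_mean (max_addmx (normalized_mx A) (normalized_mx B)) = 1.
Proof.
move=> hA hB x0 Ax Bx.
have [e [y fA]] := SR_cyclic_form hA; have [e' [z fB]] := SR_cyclic_form hB.
have [A0 _ _] := hA; have [B0 _ _] := hB.
have [e0 muA1 y0 Ae] := fA; have [_ muB1 _ _] := fB.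
have muA0 : 0 < max_cycle_mean A by apply: lt_le_trans muA1.
have muB0 : 0 < max_cycle_mean B by apply: lt_le_trans muB1.
have S0 i j : 0 <= max_addmx (normalized_mx A) (normalized_mx B) i j.
  by rewrite normalized_addE le_max mulr_ge0 // ?invr_ge0 ltW.
apply/le_anti/andP; split.
  apply: (@max_cycle_mean_le _ _ _ (fun i => x i 0)) => // i j.
  rewrite normalized_addE mul1r -ler_pdivlMr // ge_max.
  by rewrite !(mulrC _^-1) !ler_pdivlMr // !(mulrAC _ _^-1) !ler_pdivrMr //
    ![x i 0 * _]mulrC Ax Bx.
have S_ge i : y i 0 / y (i + e) 0 <=
    max_addmx (normalized_mx A) (normalized_mx B) i (i + e).
  by rewrite normalized_addE Ae -!mulrA mulKf ?lt0r_neq0 // le_max lexx.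
have := cycle3_le S0 (I3_uniq 0 e0).
have := S_ge (0 - e); have := S_ge (0 + e); have := S_ge 0.
rewrite subrK I3_addKK => S1 S2 S3 S_le.
have q0 i j : 0 <= y i 0 / y j 0 by rewrite divr_ge0 // ltW.
rewrite -(@expr_ge1 _ 3) ?max_cycle_mean_ge0 //.
apply: le_trans S_le.
apply: le_trans (ler_pM _ _ (ler_pM _ _ S1 S2) S3) => //; last first.
  by rewrite mulr_ge0.
rewrite le_eqVlt; apply/orP; left; apply/eqP.
by field; rewrite !lt0r_neq0.
Qed.

(** Since the sum dominates the normalized critical edges of both matrices, any cycle mixing such
    edges has product at most 1. This makes [x / z] monotone around Z/3, hence constant, and the
    form of [A] can be rescaled from [x] to [z]. *)
Lemma mean1_subeigen A B : SR_matrix A -> SR_matrix B ->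
  max_cycle_mean (max_addmx (normalized_mx A) (normalized_mx B)) = 1 ->
  exists x, [/\ forall i, 0 < x i 0, subeigen A x & subeigen B x].
Proof.
move=> hA hB; set S := max_addmx _ _ => S1.
have [e [x fA]] := SR_cyclic_form hA; have [e' [z fB]] := SR_cyclic_form hB.
have [A0 _ _] := hA; have [e0 muA1 x0 Ae] := fA; have [e'0 muB1 z0 Be] := fB.
have muA0 : 0 < max_cycle_mean A by apply: lt_le_trans muA1.
have muB0 : 0 < max_cycle_mean B by apply: lt_le_trans muB1.
have S0 i j : 0 <= S i j.
  by rewrite normalized_addE le_max mulr_ge0 // ?invr_ge0 ltW.
have SA i : x i 0 / x (i + e) 0 <= S i (i + e).
  by rewrite normalized_addE Ae -!mulrA mulKf ?lt0r_neq0 // le_max lexx.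
have SB i : z i 0 / z (i + e') 0 <= S i (i + e').
  by rewrite normalized_addE Be -!mulrA mulKf ?lt0r_neq0 // le_max lexx orbT.
have qx i j : 0 <= x i 0 / x j 0 by rewrite divr_ge0 // ltW.
have qz i j : 0 <= z i 0 / z j 0 by rewrite divr_ge0 // ltW.
(* The left side is the weight of a cycle going from [j] to [i] along critical edges of [B] and back
   along those of [A]. *)
have le1_u i j : z j 0 / z i 0 * (x i 0 / x j 0) <= 1 ->
    x i 0 / z i 0 <= x j 0 / z j 0.
  move=> h; rewrite -[X in X <= _]mulr1.
  have -> : x j 0 / z j 0 = x i 0 / z i 0 / (z j 0 / z i 0 * (x i 0 / x j 0)).
    by field; rewrite !lt0r_neq0.
  rewrite ler_pM2l ?divr_gt0 // invf_ge1 //.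
  by rewrite mulr_gt0 // divr_gt0.
have cst : forall i j, x i 0 / z i 0 = x j 0 / z j 0.
  have [eE|e'E|e'E] := I3_cases 0 e' e0.
  - by rewrite eE eqxx in e'0.
  - (* Same orientation: close one critical edge of [B] by two of [A]. *)
    rewrite add0r in e'E; rewrite e'E in SB.
    apply: (I3_nonincreasing_const e0) => i; apply: le1_u.
    have := cycle3_le S0 (I3_uniq i e0); rewrite S1 expr1n.
    apply: le_trans.
    have := SA (i + e); rewrite I3_addKK => SA1.
    have := SA (i - e); rewrite subrK => SA2.
    rewrite -[S i _ * _ * _]mulrA; apply: ler_pM => //.
    apply: le_trans (ler_pM _ _ SA1 SA2) => //.
    rewrite le_eqVlt; apply/orP; left; apply/eqP.
    by field; rewrite !lt0r_neq0.
  - (* Opposite orientations: the two critical edges form a 2-cycle. *)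
    have me0 : - e != 0 by have /andP[] := I3_opp e0.
    apply: (I3_nonincreasing_const me0) => i; apply: le1_u.
    have := SB i; have := SA (i - e); rewrite e'E sub0r subrK => SA1 SB1.
    have := cycle2_le S0 (I3_shift_neq i me0); rewrite S1 expr1n mulrC.
    by apply: le_trans; apply: ler_pM.
have zE i : z i 0 = z 0 0 / x 0 0 * x i 0.
  have := cst 0 i => h; apply: (mulfI (_ : x i 0 / z i 0 != 0)).
    by rewrite mulf_neq0 ?invr_eq0 ?lt0r_neq0.
  by rewrite -{2}h; field; rewrite !lt0r_neq0.
exists z; split=> //; last exact: cyclic_form_is_subeigen hB fB.
by apply: cyclic_form_is_subeigen hA (cyclic_form_scale _ zE fA); rewrite divr_gt0.
Qed.

End DimensionThree.

Theorem theorem3p2 (R : realType) (A B : 'M[R]_3)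
  (hA : SR_matrix A) (hB : SR_matrix B) :
  (max_cycle_mean (max_addmx (normalized_mx A) (normalized_mx B)) = 1
     <-> max_mulmx A B = max_mulmx B A)
  /\ (max_mulmx A B = max_mulmx B A
     <-> exists x : 'cV[R]_3,
           [/\ forall i, 0 < x i 0,
               mx_le (max_mulmx A x) (max_cycle_mean A *: x)
             & mx_le (max_mulmx B x) (max_cycle_mean B *: x)]).
Proof.
split; split.
- by move=> /(mean1_subeigen hA hB)[x [x0 Ax Bx]]; apply: subeigen_commute Ax Bx.
- by move=> /(commute_subeigen hA hB)[x [x0 Ax Bx]]; apply: subeigen_mean1 Ax Bx.
- move=> /(commute_subeigen hA hB)[x [x0 Ax Bx]]; exists x.
  by split=> //; apply/max_mulmx_scale_leP => //; exact: max_cycle_mean_ge0.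
- move=> [x [x0 /(max_mulmx_scale_leP _ (max_cycle_mean_ge0 A) x0) Ax
    /(max_mulmx_scale_leP _ (max_cycle_mean_ge0 B) x0) Bx]].
  exact: subeigen_commute Ax Bx.
Qed.
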